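(* Let $X$ be a complex Banach space and let $T\in\mathcal{B}(X)$ be a power-bounded operator such that $\sigma(T)\cap\mathbb{T}=\{1\}$. Then either $$\limsup_{n\to\infty} n\|T^n(I-T)\|>0,$$ or there exist closed $T$-invariant subspaces $X_0$ and $X_1$ of $X$ such that $X_0\subset\mathrm{Fix}(T)$, the restriction $T_1$ of $T$ to $X_1$ satisfies $r(T_1)<1$, and $X=X_0\oplus X_1$.
   Context: $\mathcal{B}(X)$ denotes the bounded linear operators on $X$; $T$ is power-bounded if $\sup_{n\geq0}\|T^n\|<\infty$. $\mathbb{T}=\{\lambda\in\mathbb{C}:|\lambda|=1\}$, $\sigma(T)$ is the spectrum, $r(\cdot)$ the spectral radius, and $\mathrm{Fix}(T)=\mathrm{Ker}(I-T)$. *)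

(* Defs.v *)
From HB Require Import structures.
From mathcomp Require Import all_boot all_order all_algebra.
From mathcomp Require Import complex.
From mathcomp Require Import all_classical all_reals all_analysis.
Set Implicit Arguments. Unset Strict Implicit. Unset Printing Implicit Defensive.
Import Order.TTheory GRing.Theory Num.Theory.
Import numFieldNormedType.Exports.
Local Open Scope classical_set_scope.
Local Open Scope ring_scope.

(* The complex Banach space X is modelled as [X : completeNormedModType R[i]]
   with [R : realType]; [R[i]] is the field of complex numbers over R. *)

Section Ops.
Variables (R : realType).
Local Notation C := (R[i]).
Variable (X : normedModType C).

Definition bounded_operator (T : X -> X) : Prop :=
  linear T /\ continuous T.

Definition opnorm (T : X -> X) : \bar R :=
  ereal_sup [set ((complex.Re `|T x|)%:E : \bar R) | x in [set x : X | `|x| <= 1]].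

Definition power_bounded (T : X -> X) : Prop :=
  exists M : R, forall n : nat, (opnorm (iter n T) <= M%:E)%E.

Definition closed_subspace (A : set X) : Prop :=
  closed A /\ A 0 /\ (forall x y, A x -> A y -> A (x + y)) /\
  (forall (c : C) x, A x -> A (c *: x)).

Definition T_invariant (T : X -> X) (A : set X) : Prop := T @` A `<=` A.

(* Spectrum of the restriction of T to a (closed, T-invariant) subspace A:
   lambda is in the resolvent set iff lambda I - T restricted to A has a
   two-sided inverse A -> A that is linear and continuous (i.e. bounded). *)
Definition spectrum_on (A : set X) (T : X -> X) : set C :=
  [set lam | ~ exists S : X -> X,
     [/\ S @` A `<=` A,
         (forall x y, A x -> A y -> S (x + y) = S x + S y),
         (forall (c : C) x, A x -> S (c *: x) = c *: S x) &
         {within A, continuous S}] /\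
     (forall x, A x -> S (lam *: x - T x) = x) /\
     (forall x, A x -> lam *: S x - T (S x) = x)].

Definition spectrum (T : X -> X) : set C := spectrum_on setT T.

(* spectral radius r = sup{|lam| : lam in spectrum}, in the extended reals
   (sup of the empty set is -oo) *)
Definition spectral_radius_on (A : set X) (T : X -> X) : \bar R :=
  ereal_sup [set ((complex.Re `|lam|)%:E : \bar R) | lam in spectrum_on A T].

Definition Fix (T : X -> X) : set X := [set x | T x = x].

Definition direct_sum (A B : set X) : Prop :=
  (forall x : X, exists a b, [/\ A a, B b & x = a + b]) /\ A `&` B = [set 0].

End Ops.

(* Main.v *)
(** If the limsup vanishes, then summing [T^k (I - T)] over [m <= k < 2m] shows
    that [||T^m - T^(2m)||] tends to 0, so [Q = T^m] is almost idempotent.  With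
    [D = Q - Q^2] and [E = Q^2 (1 - Q)], and [D'], [E'] the same expressions for
    [Q^2], one has
      [D' = 2 E - D^2]  and  [2 E = E' + (2 + 2 Q + Q^2) D^2].
    The second identity, read from [Q^2] back to [Q], makes [E] small of higher
    order, and the first then makes [D'] smaller than [D] by a fixed factor.
    Hence [T^(2^k m)] converges geometrically, uniformly on the unit ball, to a
    projection [P] with [T P = P T = P].  The decomposition is [X = Fix T + ker P]:
    for a suitable [N], [||T^N - P|| <= 1/2], so a Neumann series gives the
    resolvent of [T] on [ker P] outside a disc of radius less than 1. *)

Require Import Defs.
From HB Require Import structures.
From mathcomp Require Import all_boot all_order all_algebra.
From mathcomp Require Import complex.
From mathcomp Require Import all_classical all_reals all_analysis.
From mathcomp Require Import ring lra.
Import Order.TTheory GRing.Theory Num.Theory.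
Import numFieldNormedType.Exports.
Local Open Scope classical_set_scope.
Local Open Scope ring_scope.

(** * The norm as a real number *)

Section RealNorm.
Context {R : realType} {X : normedModType R[i]}.
Implicit Types (x y : X) (c : R[i]) (a : R).

(* In [R[i]] the norm is itself a complex number; [rnorm] is its real value. *)
Definition rnorm x : R := complex.Re `|x|.

Lemma rnormE x : `|x| = (rnorm x)%:C%C.
Proof. by rewrite /rnorm RRe_real // normr_real. Qed.

Lemma rnorm_ge0 x : 0 <= rnorm x.
Proof. by rewrite -lecR -rnormE normr_ge0. Qed.

Lemma rnorm0 : rnorm 0 = 0.
Proof. by rewrite /rnorm normr0. Qed.

Lemma rnorm_eq0 x : rnorm x = 0 -> x = 0.
Proof. by move=> x0; apply/normr0_eq0; rewrite rnormE x0. Qed.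

Lemma rnormN x : rnorm (- x) = rnorm x.
Proof. by rewrite /rnorm normrN. Qed.

Lemma rnormB x y : rnorm (x - y) = rnorm (y - x).
Proof. by rewrite /rnorm distrC. Qed.

Lemma rnormD x y : rnorm (x + y) <= rnorm x + rnorm y.
Proof. by rewrite -lecR rmorphD /= -!rnormE ler_normD. Qed.

Lemma rnormZ c x : rnorm (c *: x) = complex.Re `|c| * rnorm x.
Proof.
have := normrZ c x; rewrite !rnormE -[X in X * _]RRe_real ?normr_real//.
by rewrite -rmorphM => /complexI.
Qed.

Lemma le_rnormD x y a b : rnorm x <= a -> rnorm y <= b -> rnorm (x + y) <= a + b.
Proof. by move=> xa yb; apply: le_trans (rnormD x y) _; apply: lerD. Qed.

Lemma le_rnormB x y a b : rnorm x <= a -> rnorm y <= b -> rnorm (x - y) <= a + b.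
Proof. by move=> xa yb; apply: le_rnormD => //; rewrite rnormN. Qed.

Lemma rnormZ_le c x a b : complex.Re `|c| <= a -> rnorm x <= b ->
  rnorm (c *: x) <= a * b.
Proof.
move=> ca xb; rewrite rnormZ; apply: ler_pM => //; last exact: rnorm_ge0.
by rewrite -lecR RRe_real//; exact: normr_ge0.
Qed.

End RealNorm.

(** * Limits approached at a geometric rate *)

Section Geometric.
Context {R : realType}.
Variable r : R.
Hypotheses (r0 : 0 <= r) (r1 : r < 1).

Lemma geometric_lt (c eps : R) : 0 < eps -> exists k, c * r ^+ k < eps.
Proof.
move=> e0.
have h : c * r ^+ k @[k --> \oo] --> c * 0.
  by apply: cvgMr; apply: cvg_expr; rewrite ger0_norm.
rewrite mulr0 in h.
have /cvgr0Pnorm_lt /(_ _ e0) [k _ /(_ k)] := h.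
by move=> /(_ (leqnn k)) /= hk; exists k; apply: le_lt_trans hk; rewrite ler_norm.
Qed.

Lemma geometric_le0 (x c : R) : (forall k, x <= c * r ^+ k) -> x <= 0.
Proof.
move=> h; rewrite leNgt; apply/negP => x0.
by have [k hk] := geometric_lt c _ x0; have := h k; rewrite leNgt hk.
Qed.

Context {X : normedModType R[i]}.
Implicit Types (u : nat -> X) (l : X).

(** The rate [r] is shared and only the constant varies, so that such limits can be added and
    compared. *)
Definition geometric_limit u l := exists c, forall k, rnorm (u k - l) <= c * r ^+ k.

Lemma geometric_limit_unique u l l' :
  geometric_limit u l -> geometric_limit u l' -> l = l'.
Proof.
move=> [c hc] [c' hc']; apply/eqP; rewrite -subr_eq0; apply/eqP/rnorm_eq0.
apply/eqP; rewrite eq_le rnorm_ge0 andbT; apply: (@geometric_le0 _ (c + c')) => k.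
rewrite mulrDl -(subrKA (u k)); apply: le_rnormD => //; by rewrite rnormB.
Qed.

Lemma geometric_limitD u u' l l' : geometric_limit u l -> geometric_limit u' l' ->
  geometric_limit (fun k => u k + u' k) (l + l').
Proof.
move=> [c hc] [c' hc']; exists (c + c') => k.
by rewrite mulrDl opprD addrACA; apply: le_rnormD.
Qed.

(** Stated for any bounded map compatible with subtraction, so that it serves for scalar multiples,
    [T], [P] and [lam - T] alike. *)
Lemma geometric_limit_bounded (f : X -> X) (M : R) u l :
  (forall x y, f (x - y) = f x - f y) -> (forall x, rnorm (f x) <= M * rnorm x) ->
  0 <= M -> geometric_limit u l -> geometric_limit (f \o u) (f l).
Proof.
move=> fB fM M0 [c hc]; exists (M * c) => k.
rewrite /= -fB -mulrA; apply: le_trans (fM _) _; exact: ler_wpM2l.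
Qed.

End Geometric.

(** * Convergence from geometrically small increments *)

Section Complete.
Context {R : realType} {X : completeNormedModType R[i]}.

Lemma geometric_telescope (u : nat -> X) (c r : R) : 0 <= r -> r < 1 ->
  (forall k, rnorm (u k.+1 - u k) <= c * r ^+ k) ->
  forall k j, rnorm (u (k + j)%N - u k) <= c / (1 - r) * r ^+ k.
Proof.
move=> r0 r1 h k j.
have c0 : 0 <= c by have := h 0%N; rewrite expr0 mulr1; apply: le_trans (rnorm_ge0 _).
(* The factor [1 - r ^+ j], from the finite geometric sum, lets the induction on [j] close. *)
suff : rnorm (u (k + j)%N - u k) <= c / (1 - r) * r ^+ k * (1 - r ^+ j).
  move/le_trans; apply; apply: ler_piMr; last first.
    by rewrite lerBlDr lerDl exprn_ge0.
  by rewrite mulr_ge0 ?exprn_ge0// divr_ge0// subr_ge0 ltW.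
elim: j => [|j IH]; first by rewrite addn0 subrr rnorm0 expr0 subrr mulr0.
rewrite addnS -(subrKA (u (k + j)%N)).
apply: le_trans (le_rnormD _ _ _ _ (h _) IH) _.
rewrite exprD exprSr le_eqVlt; apply/orP; left; apply/eqP; field.
by rewrite subr_eq0 eq_sym lt_eqF.
Qed.

(** The constant stays explicit: read at [k = 0], the estimate later bounds [T^N - P] and the
    resolvent. *)
Lemma geometric_cvg (u : nat -> X) (c r : R) : 0 <= r -> r < 1 ->
  (forall k, rnorm (u k.+1 - u k) <= c * r ^+ k) ->
  exists l, forall k, rnorm (u k - l) <= c / (1 - r) * r ^+ k.
Proof.
move=> r0 r1 h.
have tele := geometric_telescope _ _ _ r0 r1 h.
have cu : cvgn u.
  apply/cauchy_cvgP/cauchy_exP => e e0.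
  (* A positive element of [R[i]] is real, so [e] is replaced by its real part. *)
  have e0' : 0 < complex.Re e by move: e0; rewrite ltcE => /andP[].
  have eE : e = (complex.Re e)%:C%C by rewrite RRe_real // gtr0_real.
  have [k hk] := geometric_lt r r0 r1 (c / (1 - r)) _ e0'.
  exists (u k); exists k => // n /= kn.
  rewrite -ball_normE /= rnormE eE ltcR rnormB -(subnKC kn).
  exact: le_lt_trans (tele _ _) hk.
exists (limn u) => k.
apply/ler_addgt0Pr => e e0.
have e0' : 0 < e%:C%C :> R[i] by rewrite ltcR.
have [n _ hn] := (cvgrPdist_lt _ _).1 cu _ e0'.
have := hn (k + n)%N (leq_addl _ _); rewrite /= rnormE ltcR => {}hn.
rewrite -(subrKA (u (k + n)%N)); apply: le_rnormD; first by rewrite rnormB.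
by rewrite rnormB ltW.
Qed.

End Complete.

(** * Squaring an almost idempotent operator *)

Section NearIdempotent.
Context {R : realType} {X : normedModType R[i]}.
Implicit Types x y : X.

(** The differences of iterates are [D' x], [E x] and [E' x]. In [D^2] one factor is bounded by the
    fixed small [eta] and the other by the current bound [u], so the quadratic term becomes linear
    in [u] with a small coefficient. *)
Lemma near_idempotent_square (Q : X -> X) (M eta u : R) :
  (forall x y, Q (x - y) = Q x - Q y) ->
  (forall x, rnorm (Q x) <= M * rnorm x) -> 0 <= M -> 0 <= eta ->
  (forall x, rnorm (Q x - Q (Q x)) <= eta * rnorm x) ->
  (forall x, rnorm (Q x - Q (Q x)) <= u * rnorm x) ->
  forall x,
    rnorm (iter 2 Q x - iter 4 Q x)
      <= 2 * rnorm (iter 2 Q x - iter 3 Q x) + eta * u * rnorm x /\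
    2 * rnorm (iter 2 Q x - iter 3 Q x)
      <= rnorm (iter 4 Q x - iter 6 Q x) + (2 + 2 * M + M ^+ 2) * (eta * u) * rnorm x.
Proof.
move=> QB QM M0 eta0 heta hu x /=.
set e := Q (Q x) - Q (Q (Q x)).
have eE : e = Q (Q x - Q (Q x)) by rewrite QB.
(* Since [e = Q (D x)], this is [D (D x)]. *)
pose w := e - Q e.
have hw : rnorm w <= eta * u * rnorm x.
  rewrite /w {1 2}eE -mulrA; apply: le_trans (heta _) _.
  exact: ler_wpM2l.
set v := eta * u * rnorm x in hw *.
have hQw : rnorm (Q w) <= M * v by apply: le_trans (QM _) _; apply: ler_wpM2l.
have hQQw : rnorm (Q (Q w)) <= M ^+ 2 * v.
  by rewrite expr2 -mulrA; apply: le_trans (QM _) _; apply: ler_wpM2l.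
have e1E : Q e = e - w by rewrite /w opprB addrC subrK.
have e2E : Q (Q e) = e - w - Q w by rewrite e1E (QB e) e1E.
have e3E : Q (Q (Q e)) = e - w - Q w - Q (Q w) by rewrite e2E (QB (e - w)) (QB e) e1E.
split.
  have -> : Q (Q x) - Q (Q (Q (Q x))) = e + e - w.
    by rewrite -addrA -e1E /e QB addrA subrK.
  by rewrite mulr2n mulrDl mul1r; apply: le_rnormB => //; apply: rnormD.
have -> : Q (Q (Q (Q x))) - Q (Q (Q (Q (Q (Q x))))) = Q (Q e) + Q (Q (Q e)).
  by rewrite /e !QB addrA subrK.
clearbody w e.
have -> : 2 * rnorm e = rnorm (e + e).
  rewrite -mulr2n -[e *+ 2]scaler_nat rnormZ normr_nat.
  by rewrite -[2%:R]/(1 + 1) raddfD.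
have -> : e + e = Q (Q e) + Q (Q (Q e)) + ((w + Q w) + (w + Q w + Q (Q w))).
  have cancel (a b c : X) : a - b - c + (b + c) = a by rewrite -[a - b - c]addrA -opprD subrK.
  rewrite addrACA e3E e2E cancel; congr (_ + _).
  by rewrite -[e - w - Q w]addrA -opprD cancel.
apply: le_trans (rnormD _ _) _; rewrite lerD2l.
have -> : (2 + 2 * M + M ^+ 2) * (eta * u) * rnorm x = (v + M * v) + (v + M * v + M ^+ 2 * v).
  by rewrite /v; ring.
by do !apply: le_rnormD.
Qed.
End NearIdempotent.

(* The two estimates of [near_idempotent_square] contract the pair of bounds
   [||D|| <= u], [||E|| <= u / 8] by the factor 3/4 at each squaring. *)
Lemma near_idempotent_geometric {R : realType} {X : normedModType R[i]}
    (Q : nat -> X -> X) (M eta : R) :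
  (forall k x, Q k.+1 x = Q k (Q k x)) ->
  (forall k x y, Q k (x - y) = Q k x - Q k y) ->
  (forall k x, rnorm (Q k x) <= M * rnorm x) -> 1 <= M -> 0 <= eta ->
  (forall k x, rnorm (Q k x - Q k.+1 x) <= eta * rnorm x) ->
  16 * (2 + 2 * M + M ^+ 2) * eta <= 1 ->
  forall k x, rnorm (Q k x - Q k.+1 x) <= 8 * M * eta * (3 / 4) ^+ k * rnorm x.
Proof.
move=> QS QB QM M1 eta0 heta small.
have small2 : eta <= 1 / 2.
  apply: le_trans (_ : (2 + 2 * M + M ^+ 2) * eta <= _); last lra.
  by apply: ler_peMl => //; have := sqr_ge0 M; lra.
(* The bound with exponent [n] is claimed for all [k >= n], because the next bound on [E] at index
   [k] uses the current one at index [k + 1]. *)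
suff H n k x : (n <= k)%N ->
    rnorm (Q k x - Q k.+1 x) <= 8 * M * eta * (3 / 4) ^+ n * rnorm x /\
    rnorm (iter 2 (Q k) x - iter 3 (Q k) x) <= M * eta * (3 / 4) ^+ n * rnorm x.
  by move=> k x; have [] := H k k x (leqnn k).
elim: n k x => [|n IH] k x nk.
  rewrite expr0 !mulr1 /= -QB; split.
    apply: le_trans (heta _ _) _; apply: ler_wpM2r; first exact: rnorm_ge0.
    by apply: ler_peMl => //; lra.
  apply: le_trans (QM _ _) _; rewrite -mulrA; apply: ler_wpM2l; first lra.
  by rewrite -QS; apply: heta.
set u := 8 * M * eta * (3 / 4) ^+ n in IH.
have u0 : 0 <= u by rewrite /u !mulr_ge0// ?exprn_ge0//; lra.
have M0 : 0 <= M by lra.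
have step j y : (n <= j)%N ->
    rnorm (iter 2 (Q j) y - iter 4 (Q j) y)
      <= 2 * rnorm (iter 2 (Q j) y - iter 3 (Q j) y) + eta * u * rnorm y /\
    2 * rnorm (iter 2 (Q j) y - iter 3 (Q j) y)
      <= rnorm (iter 4 (Q j) y - iter 6 (Q j) y) + (2 + 2 * M + M ^+ 2) * (eta * u) * rnorm y.
  move=> nj; apply: near_idempotent_square => // z; rewrite -QS //.
  by have [] := IH _ z nj.
have -> : 8 * M * eta * (3 / 4) ^+ n.+1 = 3 / 4 * u by rewrite /u exprS; ring.
have -> : M * eta * (3 / 4) ^+ n.+1 = 3 / 32 * u by rewrite /u exprS; field.
have uE : M * eta * (3 / 4) ^+ n = u / 8 by rewrite /u; field.
rewrite uE in IH.
have x0 : 0 <= u * rnorm x by rewrite mulr_ge0 ?rnorm_ge0.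
(* From [u] for [D] and [u / 8] for [E], the new bounds are [2 u / 8 + u / 2 = 3 u / 4] for [D] and
   half of [u / 8 + u / 16], that is [3 u / 32], for [E]. *)
split.
  case: k nk => // k nk.
  have [h1 _] := step k x nk; have [_ h2] := IH k x nk.
  rewrite !QS; apply: le_trans h1 _.
  have : eta * (u * rnorm x) <= 1 / 2 * (u * rnorm x) by apply: ler_wpM2r.
  lra.
have [_ h1] := step k x (ltnW nk); have [_ h2] := IH k.+1 x (leqW (ltnW nk)).
rewrite /= !QS /= in h1 h2 *.
have : 16 * (2 + 2 * M + M ^+ 2) * eta * (u * rnorm x) <= u * rnorm x.
  by apply: ler_piMl.
lra.
Qed.

(** * Iterates, continuity and kernels of linear maps *)

Section Linear.
Context {R : realType} {X : normedModType R[i]}.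
Implicit Types x y : X.

Lemma iter_linear (T : {linear X -> X}) n a x y :
  iter n T (a *: x + y) = a *: iter n T x + iter n T y.
Proof. by elim: n => //= n ->; rewrite linearP. Qed.

Lemma iter_linearB (T : {linear X -> X}) n x y :
  iter n T (x - y) = iter n T x - iter n T y.
Proof. by elim: n => //= n ->; rewrite linearB. Qed.

Lemma rnorm_bounded_continuous (f : X -> X) (M : R) :
  (forall x y, f (x - y) = f x - f y) ->
  (forall x, rnorm (f x) <= M * rnorm x) -> continuous f.
Proof.
move=> fB fM x; apply/cvgrPdist_lt => e e0.
have e0' : 0 < complex.Re e by move: e0; rewrite ltcE => /andP[].
have eE : e = (complex.Re e)%:C%C by rewrite RRe_real // gtr0_real.
pose K := `|M| + 1.
have K0 : 0 < K by rewrite ltr_wpDl.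
have d0 : 0 < (complex.Re e / K)%:C%C :> R[i] by rewrite ltcR divr_gt0.
near=> y; rewrite -fB rnormE eE ltcR.
have : `|x - y| < (complex.Re e / K)%:C%C.
  by near: y; move: (d0); apply: (cvgrPdist_lt _ _).1; exact: cvg_id.
rewrite rnormE ltcR ltr_pdivlMr// mulrC => xy; apply: le_lt_trans xy.
apply: le_trans (fM _) _; apply: ler_wpM2r; first exact: rnorm_ge0.
by rewrite (le_trans (ler_norm _))// lerDl.
Unshelve. all: by end_near. Qed.

Lemma closed_ker (f : X -> X) : continuous f -> closed [set x | f x = 0].
Proof.
move=> cf; have -> : [set x | f x = 0] = f @^-1` [set 0] by [].
apply: closed_comp => [x _|]; first exact: cf.
exact/accessible_closed_set1/hausdorff_accessible/norm_hausdorff.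
Qed.

End Linear.

(** * The limit projection of the powers *)

Section Projection.
Context {R : realType} {X : completeNormedModType R[i]}.
Variables (T : {linear X -> X}) (M : R).
Hypotheses (M1 : 1 <= M) (TM : forall n x, rnorm (iter n T x) <= M * rnorm x).
Hypothesis decay : forall eps : R, 0 < eps -> exists N, forall n, (N <= n)%N ->
  forall x, n%:R * rnorm (iter n T (x - T x)) <= eps * rnorm x.

(** The second bound telescopes: [T^n - T^(2n)] is a sum of [n] terms [T^k (I - T)] with [k >= n],
    each of norm at most [eps / n]. *)
Lemma decay_double (eps : R) : 0 < eps -> exists N, (0 < N)%N /\ forall n, (N <= n)%N ->
  forall x, n%:R * rnorm (iter n T (x - T x)) <= eps * rnorm x /\
    rnorm (iter n T x - iter (n + n) T x) <= eps * rnorm x.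
Proof.
move=> e0; have [N hN] := decay _ e0; exists N.+1; split => // n Nn x.
split; first exact/hN/ltnW.
have n0 : 0 < n%:R :> R by rewrite ltr0n (leq_trans _ Nn).
suff H j : rnorm (iter n T x - iter (n + j) T x) <= j%:R * (eps / n%:R * rnorm x).
  have := H n; congr (_ <= _); field; exact: lt0r_neq0.
elim: j => [|j IH]; first by rewrite addn0 subrr rnorm0 mul0r.
rewrite -natr1 mulrDl mul1r -(subrKA (iter (n + j) T x)); apply: le_rnormD => //.
have nj : (N <= n + j)%N by rewrite (leq_trans (ltnW Nn))// leq_addr.
rewrite addnS iterSr -iter_linearB mulrAC ler_pdivlMr// mulrC.
apply: le_trans (hN _ nj x); apply: ler_wpM2r; first exact: rnorm_ge0.
by rewrite ler_nat leq_addr.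
Qed.

Lemma power_projection : exists (P : X -> X) (N : nat),
  [/\ (0 < N)%N, forall x, rnorm (iter N T x - P x) <= 1 / 2 * rnorm x,
      forall a x y, P (a *: x + y) = a *: P x + P y,
      forall x, T (P x) = P x /\ P (T x) = P x & forall x, T x = x -> P x = x].
Proof.
pose c := 2 + 2 * M + M ^+ 2.
have c0 : 0 < c by rewrite /c; move: M1 (sqr_ge0 M); lra.
(* This gives [16 c eta = 1/4], small enough for the contraction, and, since [2 M <= c], also
   [32 M eta <= 1/4], which keeps [T^N] within 1/2 of the limit. *)
pose eta := 1 / (64 * c).
have eta0 : 0 < eta by rewrite divr_gt0// mulr_gt0.
have [N [N0 hN]] := decay_double _ eta0.
pose Q k := iter (2 ^ k * N) T.
have QS k x : Q k.+1 x = Q k (Q k x).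
  by rewrite /Q expnS -mulnA mul2n -addnn iterD.
have QB k x y : Q k (x - y) = Q k x - Q k y by exact: iter_linearB.
have etac : eta * c = 1 / 64 by rewrite /eta; field; exact: lt0r_neq0.
have Qeta k x : rnorm (Q k x - Q k.+1 x) <= 8 * M * eta * (3 / 4) ^+ k * rnorm x.
  apply: near_idempotent_geometric => //; first 1 last.
  - exact: ltW.
  - move=> j y; rewrite QS /Q -iterD; apply: (hN _ _ y).2.
    by rewrite leq_pmull// expn_gt0.
  - by rewrite -/c mulrAC -mulrA etac; lra.
  - by move=> j y; exact: TM.
have r0 : 0 <= 3 / 4 :> R by lra.
have r1 : 3 / 4 < 1 :> R by lra.
have /choice [P hP] x : exists l, forall k, rnorm (Q k x - l) <=
    8 * M * eta * rnorm x / (1 - 3 / 4) * (3 / 4) ^+ k.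
  apply: geometric_cvg => // k; rewrite rnormB; apply: le_trans (Qeta _ _) _.
  by rewrite mulrAC.
have limP x : geometric_limit (3 / 4) (Q ^~ x) (P x) by eexists => k; exact: hP.
have uniq := geometric_limit_unique _ r0 r1.
exists P, N; split => //.
- move=> x; have := hP x 0%N; rewrite /Q expn0 mul1n expr0 mulr1 => /le_trans; apply.
  have -> : 8 * M * eta * rnorm x / (1 - 3 / 4) = 32 * (M * eta) * rnorm x by field.
  apply: ler_wpM2r; first exact: rnorm_ge0.
  have : eta * (2 + 2 * M + M ^+ 2) = 1 / 64 := etac.
  by move: M1 (mulr_ge0 (ltW eta0) (sqr_ge0 M)); lra.
- move=> a x y; apply: (uniq _ (Q ^~ (a *: x + y))) => //.
  have -> : Q ^~ (a *: x + y) = (fun k => a *: Q k x + Q k y).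
    by apply/funext => k; exact: iter_linear.
  apply: geometric_limitD => //.
  apply: (geometric_limit_bounded _ ( *:%R a) (complex.Re `|a|)) => //.
  + by move=> u v; rewrite scalerBr.
  + by move=> u; rewrite rnormZ.
  + by rewrite -lecR RRe_real ?normr_real//; exact: normr_ge0.
- move=> x.
  have TQ : geometric_limit (3 / 4) (fun k => T (Q k x)) (T (P x)).
    apply: (geometric_limit_bounded _ T M) => //; [exact: linearB|exact: (TM 1)|].
    by move: M1; lra.
  suff TP : T (P x) = P x.
    split => //; rewrite -[RHS]TP; apply: (uniq _ (Q ^~ (T x))) => //.
    by rewrite (_ : Q ^~ (T x) = fun k => T (Q k x))//; apply/funext => k; rewrite /Q -iterSr.
  apply: (uniq _ (Q ^~ x)) => //.
  (* In this splitting the second summand tends to [T (P x)], so it remains to see that the first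
     tends to 0. *)
  have -> : Q ^~ x = (fun k => Q k (x - T x) + T (Q k x)).
    by apply/funext => k; rewrite QB /Q -iterSr subrK.
  rewrite -[T (P x)]add0r; apply: geometric_limitD => //.
  exists (eta * rnorm x) => k; rewrite subr0.
  have kN : (N <= 2 ^ k * N)%N by rewrite leq_pmull// expn_gt0.
  have := (hN _ kN x).1; rewrite -/(Q k) => h.
  (* The decay estimate carries the factor [2^k N], and [(3/4)^k 2^k N >= 1]; hence the rate
     [(3/4)^k]. *)
  apply: (@le_trans _ _ ((3 / 4) ^+ k * ((2 ^ k * N)%:R * rnorm (Q k (x - T x))))).
    rewrite mulrA natrM mulrA natrX -exprMn; apply: ler_peMl; first exact: rnorm_ge0.
    rewrite -[leLHS]mulr1; apply: ler_pM => //; last by rewrite ler1n.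
    by apply: exprn_ege1; lra.
  by rewrite mulrC; apply: ler_wpM2r => //; exact: exprn_ge0.
- move=> x Tx; apply: (uniq _ (Q ^~ x)) => //; exists 0 => k.
  by rewrite (_ : Q k x = x) ?subrr ?rnorm0 ?mul0r// /Q iter_fix.
Qed.

End Projection.

(** * Linear functions and Bernoulli's inequality *)

Lemma linear_funP {K : pzRingType} {V W : lmodType K} (f : V -> W) : linear f ->
  [/\ f 0 = 0, forall x y, f (x - y) = f x - f y & forall a x, f (a *: x) = a *: f x].
Proof.
move=> f_linear.
have fB x y : f (x - y) = f x - f y.
  by rewrite addrC -scaleN1r f_linear scaleN1r addrC.
have f0 : f 0 = 0 by rewrite -[0]subr0 fB subrr.
by split => // a x; rewrite -[a *: x]addr0 f_linear f0 addr0.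
Qed.

Lemma bernoulli_inequality {R : realFieldType} (a : R) n : 0 <= a -> a <= 1 ->
  1 - n%:R * a <= (1 - a) ^+ n.
Proof.
move=> a0 a1; elim: n => [|n IH]; first by rewrite mul0r subr0.
have h : (1 - n%:R * a) * (1 - a) <= (1 - a) ^+ n * (1 - a).
  by apply: ler_wpM2r => //; rewrite subr_ge0.
rewrite exprSr; apply: le_trans h; rewrite -natr1.
have : 0 <= n%:R * a * a by rewrite !mulr_ge0.
lra.
Qed.

(** * Decay and resolvent on the kernel of [P] *)

Section Restriction.
Context {R : realType} {X : completeNormedModType R[i]}.
Variables (T : {linear X -> X}) (P : X -> X) (M : R).
Hypotheses (M1 : 1 <= M) (TM : forall n x, rnorm (iter n T x) <= M * rnorm x).
Hypothesis P_linear : forall a x y, P (a *: x + y) = a *: P x + P y.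
Hypothesis PT : forall x, P (T x) = P x.
Hypothesis PP : forall x, P (P x) = P x.

(** By Bernoulli's inequality [r = 1 - 1/(2N)] satisfies [r^N >= 1/2]. Exponents below [N] are
    absorbed into [C = M / r^N], and each further block of [N] iterations contributes a factor
    [1/2 <= r^N]. *)
Lemma iter_decay (N : nat) :
  (0 < N)%N -> (forall x, P x = 0 -> rnorm (iter N T x) <= 1 / 2 * rnorm x) ->
  exists C r : R, [/\ 0 <= C, 0 < r, r < 1 &
    forall n x, P x = 0 -> rnorm (iter n T x) <= C * r ^+ n * rnorm x].
Proof.
move=> N0 hN.
have n0 : 0 < N%:R :> R by rewrite ltr0n.
have n1 : 1 <= N%:R :> R by rewrite ler1n.
pose a : R := 1 / (2 * N%:R).
have a0 : 0 < a by rewrite divr_gt0// mulr_gt0.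
have Na : N%:R * a = 1 / 2 by rewrite /a; field; exact: lt0r_neq0.
have a1 : a <= 1 / 2 by rewrite -Na; apply: ler_peMl => //; exact: ltW.
pose r := 1 - a.
have r0 : 0 < r by rewrite /r; lra.
have rN : 1 / 2 <= r ^+ N.
  by apply: le_trans (bernoulli_inequality _ _ _ _); rewrite ?Na; lra.
exists (M / r ^+ N), r; split => //; [|by rewrite /r; lra|].
  by rewrite divr_ge0 ?exprn_ge0// ltW//; move: M1; lra.
move=> n x Px; elim/ltn_ind: n => n IH.
have [nN|Nn] := ltnP n N.
  apply: le_trans (TM _ _) _; apply: ler_wpM2r; first exact: rnorm_ge0.
  rewrite -mulrA; apply: ler_peMr; first by move: M1; lra.
  rewrite mulrC ler_pdivlMr ?exprn_gt0// mul1r.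
  by apply: ler_wiXn2l; [exact: ltW|rewrite /r; lra|exact: ltnW].
have PTn k : P (iter k T x) = 0 by elim: k => //= k; rewrite PT.
rewrite -{1}(subnKC Nn) iterD; apply: le_trans (hN _ (PTn _)) _.
have lt : (n - N < n)%N by rewrite ltn_subrL N0 (leq_trans N0).
have := IH _ lt => h.
have C0 : 0 <= M / r ^+ N * r ^+ (n - N) * rnorm x by exact: le_trans (rnorm_ge0 _) h.
rewrite -[in r ^+ n](subnKC Nn) exprD.
apply: le_trans (_ : r ^+ N * (M / r ^+ N * r ^+ (n - N) * rnorm x) <= _).
  by apply: ler_pM => //; exact: rnorm_ge0.
by rewrite le_eqVlt; apply/orP; left; apply/eqP; ring.
Qed.

(** The inverse of [lam - T] is the Neumann series of the [mu^(j+1) T^j] with [mu = 1 / lam], which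
    converges on [ker P] because [|mu| r < 1]. *)
Lemma ker_resolvent (Mp C r : R) (lam mu : R[i]) :
  (forall x, rnorm (P x) <= Mp * rnorm x) -> 0 <= Mp ->
  0 <= C -> 0 <= r ->
  (forall n x, P x = 0 -> rnorm (iter n T x) <= C * r ^+ n * rnorm x) ->
  lam * mu = 1 -> complex.Re `|mu| * r < 1 ->
  ~ spectrum_on [set x | P x = 0] T lam.
Proof.
move=> PM Mp0 C0 r0 hC lm mr1 /=; apply; set m := complex.Re `|mu| in mr1.
have m0 : 0 <= m by rewrite -lecR RRe_real ?normr_real//; exact: normr_ge0.
have mr0 : 0 <= m * r by exact: mulr_ge0.
have muX k : complex.Re `|mu ^+ k| = m ^+ k.
  rewrite normrX (_ : `|mu| = m%:C%C) ?RRe_real ?normr_real//.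
  by rewrite -rmorphXn.
(* Composing with this projection onto [ker P] makes the series converge on all of [X], with a
   linear and continuous sum. *)
pose J x := x - P x.
have J_linear a x y : J (a *: x + y) = a *: J x + J y.
  by rewrite /J P_linear opprD addrACA scalerBr.
have [P0 PB PZ] := linear_funP _ P_linear.
have PJ x : P (J x) = 0 by rewrite /J PB PP subrr.
have JA x : P x = 0 -> J x = x by move=> Px; rewrite /J Px subr0.
have JM x : rnorm (J x) <= (1 + Mp) * rnorm x.
  by rewrite mulrDl mul1r; apply: le_rnormB.
pose u k y := \sum_(j < k) mu ^+ j.+1 *: iter j T y.
have u_linear k a x y : u k (a *: x + y) = a *: u k x + u k y.
  rewrite /u scaler_sumr -big_split; apply: eq_bigr => j _ /=.
  by rewrite iter_linear scalerDr !scalerA mulrC.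
have Pu k x : P x = 0 -> P (u k x) = 0.
  move=> Px; rewrite /u; elim: k => [|k IH]; first by rewrite big_ord0.
  rewrite big_ord_recr /= addrC P_linear IH addr0.
  have -> : P (iter k T x) = 0 by elim: k {IH} => //= k; rewrite PT.
  by rewrite scaler0.
have term k x : P x = 0 -> rnorm (mu ^+ k *: iter k T x) <= C * rnorm x * (m * r) ^+ k.
  move=> Px; rewrite exprMn mulrA [_ * m ^+ k]mulrC -mulrA.
  apply: rnormZ_le; first by rewrite muX.
  by rewrite mulrAC; exact: hC.
(* As [lam mu = 1], the sum telescopes; on [ker P] the remainder tends to 0. *)
have resolve k x : lam *: u k x - T (u k x) = x - mu ^+ k *: iter k T x.
  elim: k => [|k IH].
    by rewrite /u big_ord0 scaler0 linear0 subrr expr0 scale1r subrr.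
  rewrite /u big_ord_recr /= -/(u k x) [T _]linearD scalerDr opprD addrACA IH.
  rewrite scalerA exprS mulrA lm mul1r [T _]linearZ /=.
  by rewrite subrKA.
have uT k x : u k (T x) = T (u k x).
  rewrite /u linear_sum; apply: eq_bigr => j _.
  by rewrite -iterSr /= linearZ.
have /choice [S hS] x : exists l, forall k, rnorm (u k (J x) - l) <=
    m * (C * rnorm (J x)) / (1 - m * r) * (m * r) ^+ k.
  apply: geometric_cvg => // k; rewrite /u big_ord_recr /= [X in rnorm X]addrC addKr.
  rewrite exprS -scalerA -mulrA; apply: rnormZ_le => //.
  exact: term.
have uniq := geometric_limit_unique _ mr0 mr1.
have limS x : geometric_limit (m * r) (fun k => u k (J x)) (S x).
  by eexists => k; exact: hS.
have S_linear a x y : S (a *: x + y) = a *: S x + S y.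
  apply: (uniq _ (fun k => u k (J (a *: x + y)))) => //.
  have -> : (fun k => u k (J (a *: x + y))) = (fun k => a *: u k (J x) + u k (J y)).
    by apply/funext => k; rewrite J_linear u_linear.
  apply: geometric_limitD => //.
  apply: (geometric_limit_bounded _ ( *:%R a) (complex.Re `|a|)) => //.
  + by move=> v w; rewrite scalerBr.
  + by move=> v; rewrite rnormZ.
  + by rewrite -lecR RRe_real ?normr_real//; exact: normr_ge0.
have [S0 SB SZ] := linear_funP _ S_linear.
have residual x : P x = 0 ->
    geometric_limit (m * r) (fun k => x - mu ^+ k *: iter k T x) x.
  move=> Px; exists (C * rnorm x) => k.
  by rewrite addrC addKr rnormN; exact: term.
exists S; split; first split.
- move=> _ [x _ <-] /=; apply: (uniq _ (fun k => P (u k (J x)))).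
    exact: (geometric_limit_bounded _ P Mp).
  by exists 0 => k; rewrite Pu // subrr rnorm0 mul0r.
- by move=> x y _ _; rewrite -[x]scale1r S_linear !scale1r.
- by move=> c x _; exact: SZ.
- apply/continuous_subspaceT/(rnorm_bounded_continuous _ (m * C * (1 + Mp) / (1 - m * r))) => // x.
  (* At [k = 0] the partial sum is empty, so the rate estimate bounds [S x] itself. *)
  have := hS x 0%N; rewrite /u big_ord0 sub0r rnormN expr0 mulr1.
  move=> /le_trans; apply; rewrite [leRHS]mulrAC; apply: ler_wpM2r.
    by rewrite invr_ge0 subr_ge0 ltW.
  by rewrite -!mulrA; do 2 apply: ler_wpM2l => //.
(* Both inverse identities are limits of [resolve]; the first also uses that [u k] commutes with
   [T]. *)
- split => x /= Px.
    apply: (uniq _ (fun k => u k (J (lam *: x - T x)))) => //.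
    have PL : P (lam *: x - T x) = 0.
      by rewrite PB PZ PT Px scaler0 subrr.
    rewrite JA//.
    have -> : (fun k => u k (lam *: x - T x)) = (fun k => x - mu ^+ k *: iter k T x).
      apply/funext => k; have [_ uB uZ] := linear_funP _ (u_linear k).
      by rewrite uB uZ uT resolve.
    exact: residual.
  apply: (uniq _ (fun k => lam *: u k (J x) - T (u k (J x)))).
    apply: (geometric_limit_bounded _ (fun z => lam *: z - T z) (complex.Re `|lam| + M)) => //.
    + by move=> v w; rewrite scalerBr [T _]linearB opprD addrACA -opprD.
    + move=> v; rewrite mulrDl; apply: le_rnormB; last exact: (TM 1).
      by rewrite rnormZ.
    + rewrite addr_ge0//; last by move: M1; lra.
      by rewrite -lecR RRe_real ?normr_real//; exact: normr_ge0.
  have -> : (fun k => lam *: u k (J x) - T (u k (J x))) = (fun k => x - mu ^+ k *: iter k T x).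
    by apply/funext => k; rewrite resolve JA.
  exact: residual.
Qed.
End Restriction.

(** * From operator norm and limsup to pointwise bounds *)

(** A nonzero [x] is scaled to norm 1, into the ball over which [opnorm] takes its supremum. *)
Lemma opnorm_bound {R : realType} {X : normedModType R[i]} (g : X -> X) (c : R) :
  linear g -> (opnorm g <= c%:E)%E -> forall x, rnorm (g x) <= c * rnorm x.
Proof.
move=> /linear_funP[g0 _ gZ] gc x.
have [->|x0] := eqVneq x 0; first by rewrite g0 rnorm0 mulr0.
have nx : 0 < rnorm x.
  by rewrite lt_neqAle rnorm_ge0 andbT; apply: contra x0 => /eqP/esym/rnorm_eq0 ->.
pose a : R[i] := ((rnorm x)^-1)%:C%C.
have ra : complex.Re `|a| = (rnorm x)^-1.
  by rewrite ger0_norm// lecR invr_ge0 ltW.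
have : ((rnorm (g (a *: x)))%:E <= c%:E)%E.
  apply: le_trans gc; apply: ereal_sup_ubound; exists (a *: x) => //=.
  by rewrite rnormE rnormZ ra mulVf ?gt_eqF.
by rewrite lee_fin gZ rnormZ ra mulrC ler_pdivrMr.
Qed.

(** The limsup is the infimum of the tail suprema, so some tail supremum is already below [eps]. *)
Lemma limn_esup_lt_near {R : realType} (f : nat -> \bar R) (eps : \bar R) :
  (limn_esup f < eps)%E -> exists N, forall n, (N <= n)%N -> (f n < eps)%E.
Proof.
rewrite limn_esup_lim (cvg_lim _ (@cvg_esups_inf _ f))//.
move=> /ereal_inf_lt[_ [N _ <-] fN]; exists N => n Nn; apply: le_lt_trans fN.
by apply: ereal_sup_ubound; exists n.
Qed.

(** * The decomposition of the space *)

Theorem theorem2p1 (R : realType) (X : completeNormedModType R[i]) (T : X -> X) :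
  bounded_operator T ->
  power_bounded T ->
  [set lam | spectrum T lam /\ `|lam| = 1] = [set 1] ->
  (0 < limn_esup (fun n : nat => (n%:R)%:E * opnorm (fun x : X => iter n T (x - T x)%R)))%E
  \/
  (exists X0 X1 : set X,
     [/\ closed_subspace X0, closed_subspace X1,
         T_invariant T X0 & T_invariant T X1] /\
     [/\ X0 `<=` Fix T,
         (spectral_radius_on X1 T < 1%:E)%E &
         direct_sum X0 X1]).
Proof.
move=> [T_linear T_cont] [M0 TM0] _.
have [|le0] := ltP 0%E (limn_esup (fun n : nat =>
  (n%:R)%:E * opnorm (fun x : X => iter n T (x - T x)%R)))%E; first by left.
right.
pose Tl : {linear X -> X} := HB.pack T (GRing.isLinear.Build _ _ _ _ T T_linear).
pose M := Num.max M0 1.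
have M1 : 1 <= M by rewrite le_max lexx orbT.
have TM n x : rnorm (iter n Tl x) <= M * rnorm x.
  apply: opnorm_bound; first exact: iter_linear.
  by apply: le_trans (TM0 n) _; rewrite lee_fin le_max lexx.
have decay (eps : R) : 0 < eps -> exists N, forall n, (N <= n)%N ->
    forall x, n%:R * rnorm (iter n Tl (x - Tl x)) <= eps * rnorm x.
  move=> e0; have /limn_esup_lt_near[N hN] := le_lt_trans le0 (e0 : (0 < eps%:E)%E).
  exists N => n Nn x; have [->|n0] := posnP n.
    by rewrite mul0r mulr_ge0 ?rnorm_ge0// ltW.
  have n0' : 0 < n%:R :> R by rewrite ltr0n.
  rewrite mulrC -ler_pdivlMr// mulrAC.
  apply: (opnorm_bound (fun x => iter n Tl (x - Tl x))).
    move=> a y z; rewrite linearP opprD addrACA -scalerBr; exact: iter_linear.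
  have := ltW (hN n Nn); rewrite muleC -lee_pdivlMr//.
have [P [N [N0 PN P_linear TPT fixP]]] := power_projection Tl M M1 TM decay.
have TP x : Tl (P x) = P x by have [] := TPT x.
have PT x : P (Tl x) = P x by have [] := TPT x.
(* [P x] is fixed by [T], and [P] fixes the fixed points of [T]. *)
have PP x : P (P x) = P x by exact: fixP.
have [T0 _ TZ] := linear_funP _ T_linear.
have [P0 PB PZ] := linear_funP _ P_linear.
have PM x : rnorm (P x) <= (M + 1 / 2) * rnorm x.
  rewrite mulrDl -[P x](subKr (iter N Tl x)); exact: le_rnormB.
exists (Fix T), [set x | P x = 0].
have fixE : Fix T = [set x | x - T x = 0].
  by apply/seteqP; split => x /= => [->|/eqP]; rewrite ?subrr// subr_eq0 => /eqP.
split; split => //.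
- split; last split; last split.
  + rewrite fixE; apply: closed_ker => x; apply: cvgB; [exact: cvg_id|exact: T_cont].
  + exact: T0.
  + by move=> x y Tx Ty; have := linearD Tl x y; rewrite /= (Tx : T x = x) (Ty : T y = y).
  + by move=> c x Tx; rewrite /Fix /= TZ (Tx : T x = x).
- split; last split; last split; [|exact: P0| |].
  + by apply: closed_ker; exact: rnorm_bounded_continuous PM.
  + by move=> x y /= Px Py; rewrite -[x]scale1r P_linear Px Py scaler0 addr0.
  + by move=> c x /= Px; rewrite PZ Px scaler0.
- by move=> _ [x Tx <-]; rewrite /Fix /= Tx.
- by move=> _ [x Px <-] /=; rewrite (PT x).
(* On [ker P] the estimate [||T^N - P|| <= 1/2] says that [T^N] halves norms. *)
- have [|C [r [C0 r0 r1 hC]]] := iter_decay Tl P M M1 TM PT N N0.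
    by move=> x Px; have := PN x; rewrite Px subr0.
  (* The midpoint of [r] and 1 leaves room on both sides: the supremum stays below 1, and any [lam]
     of larger modulus is nonzero with [r / |lam| < 1]. *)
  apply: (@le_lt_trans _ _ ((1 + r) / 2)%:E); last by rewrite lte_fin; lra.
  apply: ge_ereal_sup => _ [lam hlam <-]; rewrite lee_fin leNgt; apply/negP => lam_gt.
  have l0 : 0 < complex.Re `|lam| by lra.
  have lam0 : lam != 0.
    by apply: contraTneq l0 => ->; rewrite normr0 ltxx.
  apply: (ker_resolvent Tl P M M1 TM P_linear PT PP (M + 1 / 2) C r lam lam^-1) => //.
  + by lra.
  + exact: ltW.
  + exact: divff.
  + have -> : complex.Re `|lam^-1| = (complex.Re `|lam|)^-1.
      rewrite normfV -[in LHS](RRe_real (normr_real lam)).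
      by rewrite -fmorphV.
    by rewrite mulrC ltr_pdivrMr// mul1r; lra.
- split.
    move=> x; exists (P x), (x - P x); split; [exact: TP| |by rewrite addrC subrK].
    by rewrite /= PB PP subrr.
  apply/seteqP; split => x /=.
    (* A fixed point in [ker P] satisfies [x = P x = 0]. *)
    by move=> [Tx Px]; rewrite -(fixP x Tx).
  by move=> ->; split; [exact: T0|].
Qed.
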